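(* For $\mathbb K=\mathbb R,\mathbb C,\mathbb H,\mathbb O$, with $n=\dim_{\mathbb R}\mathbb K=1,2,4,8$ respectively, the following explicit maps $\varphi\colon\mathfrak{sl}(2,\mathbb K)\to\mathfrak{so}(n+1,1)$ are Lie algebra isomorphisms. (1) $\mathbb K=\mathbb R$: $\varphi\begin{pmatrix}a&b\\c&-a\end{pmatrix}=\begin{pmatrix}0&b+c&2a\\ b+c&0&c-b\\ 2a&b-c&0\end{pmatrix}$. (2) $\mathbb K=\mathbb C$: $\varphi\begin{pmatrix}\alpha_0+\alpha_1i&\beta_0+\beta_1i\\ \gamma_0+\gamma_1i&-\alpha_0-\alpha_1i\end{pmatrix}=\begin{pmatrix}0&\beta_0+\gamma_0&\beta_1-\gamma_1&2\alpha_0\\ \gamma_0+\beta_0&0&-2\alpha_1&\gamma_0-\beta_0\\ \beta_1-\gamma_1&2\alpha_1&0&-\beta_1-\gamma_1\\ 2\alpha_0&\beta_0-\gamma_0&\beta_1+\gamma_1&0\end{pmatrix}$. (3) $\mathbb K=\mathbb H$: for $N=\begin{pmatrix}\alpha&\beta\\ \gamma&\delta\end{pmatrix}\in\mathfrak{sl}(2,\mathbb H)$ with $\alpha=\alpha_0+\alpha_1i+\alpha_2j+\alpha_3k$ and $\beta,\gamma,\delta$ written in the same way, $$\varphi(N)=\begin{pmatrix}0&\beta_0+\gamma_0&\beta_1-\gamma_1&\beta_2-\gamma_2&\beta_3-\gamma_3&2\alpha_0\\ \beta_0+\gamma_0&0&\delta_1-\alpha_1&\delta_2-\alpha_2&\delta_3-\alpha_3&\gamma_0-\beta_0\\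 \beta_1-\gamma_1&\alpha_1-\delta_1&0&-(\alpha_3+\delta_3)&\alpha_2+\delta_2&-(\beta_1+\gamma_1)\\ \beta_2-\gamma_2&\alpha_2-\delta_2&\alpha_3+\delta_3&0&-(\alpha_1+\delta_1)&-(\beta_2+\gamma_2)\\ \beta_3-\gamma_3&\alpha_3-\delta_3&-(\alpha_2+\delta_2)&\alpha_1+\delta_1&0&-(\beta_3+\gamma_3)\\ 2\alpha_0&\beta_0-\gamma_0&\beta_1+\gamma_1&\beta_2+\gamma_2&\beta_3+\gamma_3&0\end{pmatrix}.$$ (4) $\mathbb K=\mathbb O$: $\varphi$ is the linear map on $\mathfrak{sl}(2,\mathbb O)=M_2'(\mathbb O)\oplus C(\mathbb O')\oplus\mathfrak{Der}(\mathbb O)$ given as follows. For $N=\begin{pmatrix}a&b\\c&-a\end{pmatrix}\in M_2'(\mathbb O)$ with $a=a_0+\sum_{i=1}^7a_ie_i$, $\vec a=(a_1,\dots,a_7)^T$, and similarly for $b,c$, $$\varphi(N)=\begin{pmatrix}0&b_0+c_0&(\vec b-\vec c)^T&2a_0\\ b_0+c_0&0&-2\vec a^{\,T}&c_0-b_0\\ \vec b-\vec c&2\vec a&0_{7\times7}&-(\vec b+\vec c)\\ 2a_0&b_0-c_0&(\vec b+\vec c)^T&0\end{pmatrix},$$ and for $C_d\in C(\mathbb O')$ and $\mathfrak g\in\mathfrak{Der}(\mathbb O)$, $\varphi(C_d)$ and $\varphi(\mathfrak g)$ are the block diagonal $10\times10$ matrices with diagonal blocks $0,0,A,0$ of sizes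 $1,1,7,1$, where $A$ is the $7\times7$ matrix, in the basis $e_1,\dots,e_7$ of $\mathbb O'$, of the restriction to $\mathbb O'$ of $C_d$, respectively of $\mathfrak g$. This $\varphi$ is a linear bijection onto $\mathfrak{so}(9,1)$, and it is a Lie algebra isomorphism when $\mathfrak{sl}(2,\mathbb O)$ carries the bracket $[\mathcal M,\mathcal N]=\varphi^{-1}\big(\varphi(\mathcal M)\varphi(\mathcal N)-\varphi(\mathcal N)\varphi(\mathcal M)\big)$.
   Context: For $m\ge1$, $\mathfrak{so}(m,1)=\{\omega\in M_{m+1}(\mathbb R):\eta\,\omega=-(\eta\,\omega)^T\}$ with $\eta=\mathrm{diag}(1,-1,\dots,-1)$ of size $m+1$, and bracket $[\omega,\omega']=\omega\omega'-\omega'\omega$. For $\mathbb K=\mathbb R,\mathbb C$, $\mathfrak{sl}(2,\mathbb K)$ is the real Lie algebra of traceless $2\times2$ matrices over $\mathbb K$, and $\mathfrak{sl}(2,\mathbb H)=\{N\in M_2(\mathbb H):\mathrm{Re}(\mathrm{Tr}(N))=0\}$, in each case with the matrix commutator as bracket. $\mathbb O$ is the algebra of octonions with standard basis $e_0=1,e_1,\dots,e_7$; $M_2'(\mathbb O)$ is the space of traceless $2\times2$ octonionic matrices; $\mathbb O'$ is the space of octonions with zero real part; $C(\mathbb O')=\{C_d:d\in\mathbb O'\}$ with $C_d(x)=dx-xd$; $\mathfrak{Der}(\mathbb O)\cong\mathfrak g_2$ is the space of derivations of $\mathbb O$. As a vector space $\mathfrak{sl}(2,\mathbb O)$ is defined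 to be $M_2'(\mathbb O)\oplus C(\mathbb O')\oplus\mathfrak{Der}(\mathbb O)$. The maps $\varphi$ come from the action on Hermitian matrices: a vector $(x_0,\dots,x_{n+1})\in\mathbb R^{n+2}$ is identified with $X=\begin{pmatrix}x_0+x_{n+1}&x\\ \bar x&x_0-x_{n+1}\end{pmatrix}$, where $x\in\mathbb K$ has coordinates $(x_1,\dots,x_n)$ in the standard basis of $\mathbb K$ (the first basis element being $1$); a matrix $N$ acts by $X\mapsto NX+XN^\dagger$ (with $\dagger$ the conjugate transpose), and $C_d$, $\mathfrak g$ act entrywise. *)

(* Defs.v *)
From HB Require Import structures.
From mathcomp Require Import all_boot all_order all_algebra.
From mathcomp Require Import all_classical all_reals.
From mathcomp Require Import complex.
From mathcomp Require Import ring.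

Set Implicit Arguments.
Unset Strict Implicit.
Unset Printing Implicit Defensive.

Import Order.TTheory GRing.Theory Num.Theory.
Local Open Scope ring_scope.

Record is_lie_bracket (R : pzRingType) (L : lmodType R) (br : L -> L -> L) :
    Prop := IsLieBracket {
  lie_linearl : forall y, linear (br^~ y);
  lie_linearr : forall x, linear (br x);
  lie_alternating : forall x, br x x = 0;
  lie_jacobi : forall x y z,
    br x (br y z) + br y (br z x) + br z (br x y) = 0
}.

Record is_lie_isomorphism (R : pzRingType) (L L' : lmodType R)
    (br : L -> L -> L) (br' : L' -> L' -> L') (f : L -> L') :
    Prop := IsLieIsomorphism {
  lie_iso_dom : is_lie_bracket br;
  lie_iso_cod : is_lie_bracket br';
  lie_iso_linear : linear f;
  lie_iso_bij : bijective f;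
  lie_iso_bracket : forall x y, f (br x y) = br' (f x) (f y)
}.

Definition mxcommutator (K : pzRingType) n (A B : 'M[K]_n) : 'M[K]_n :=
  A *m B - B *m A.

Definition matrix_of_rows (K : nmodType) n (s : seq (seq K)) : 'M[K]_n :=
  \matrix_(i, j) nth 0 (nth [::] s i) j.

Section SO.
Variables (R : realType) (m : nat).

Definition minkowski : 'M[R]_m.+1 :=
  diag_mx (\row_i (if i == 0 then 1 else -1)).

Definition so_pred : {pred 'M[R]_m.+1} :=
  fun w => minkowski *m w == - (minkowski *m w)^T.

Lemma so_submod_closed : submod_closed so_pred.
Proof.
split=> [|a u v]; rewrite !unfold_in; first by rewrite mulmx0 trmx0 oppr0.
move=> /eqP hu /eqP hv; rewrite mulmxDr -scalemxAr {1}hu {1}hv.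
by rewrite linearP /= opprD scalerN.
Qed.

HB.instance Definition _ :=
  GRing.isSubmodClosed.Build R 'M[R]_m.+1 so_pred so_submod_closed.

Record so : Type := So { so_mx :> 'M[R]_m.+1; _ : so_mx \in so_pred }.

HB.instance Definition _ := [isSub for so_mx].
HB.instance Definition _ := [Choice of so by <:].
HB.instance Definition _ := [SubChoice_isSubLmodule of so by <:].

Lemma so_commutator (u v : so) : mxcommutator u v \in so_pred.
Proof.
case: u v => [u hu] [v hv] /=; move: hu hv; rewrite !unfold_in.
move=> /eqP hu /eqP hv.
have eT : minkowski^T = minkowski by exact: tr_diag_mx.
have etr w : minkowski *m w = - (minkowski *m w)^T ->
    w^T *m minkowski = - (minkowski *m w).
  by move=> ->; rewrite opprK trmx_mul eT.
have key a b : minkowski *m a = - (minkowski *m a)^T ->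
    minkowski *m b = - (minkowski *m b)^T ->
    (minkowski *m (a *m b))^T = minkowski *m (b *m a).
  move=> ha hb; rewrite trmx_mul eT trmx_mul -(mulmxA b^T) etr //.
  by rewrite mulmxN (mulmxA b^T) etr // mulNmx opprK mulmxA.
by rewrite mulmxBr linearB /= !key // opprB.
Qed.

Definition so_bracket (u v : so) : so := So (so_commutator u v).

End SO.

(* If K is a ring that is also a left R-module, 'M[K]_2 is a K-module in the  *)
(* library; mat2 K carries the entrywise R-module structure instead, which    *)
(* also makes sense for the nonassociative algebra of octonions.              *)
Definition mat2 (R : pzRingType) (K : lmodType R) : Type := 'M[K]_2.
Identity Coercion matrix_of_mat2 : mat2 >-> matrix.

Section Mat2.
Variables (R : pzRingType) (K : lmodType R).

HB.instance Definition _ := GRing.Zmodule.copy (mat2 K) 'M[K]_2.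

Definition mat2_scale (a : R) (N : mat2 K) : mat2 K := map_mx ( *:%R a) N.

Fact mat2_scaleA a b N :
  mat2_scale a (mat2_scale b N) = mat2_scale (a * b) N.
Proof. by apply/matrixP=> i j; rewrite !mxE scalerA. Qed.

Fact mat2_scale1 : left_id 1 mat2_scale.
Proof. by move=> N; apply/matrixP=> i j; rewrite !mxE scale1r. Qed.

Fact mat2_scaleDr : right_distributive mat2_scale +%R.
Proof. by move=> a M N; apply/matrixP=> i j; rewrite !mxE scalerDr. Qed.

Fact mat2_scaleDl N : {morph mat2_scale^~ N : a b / a + b}.
Proof. by move=> a b; apply/matrixP=> i j; rewrite !mxE scalerDl. Qed.

HB.instance Definition _ := GRing.Zmodule_isLmodule.Build R (mat2 K)
  mat2_scaleA mat2_scale1 mat2_scaleDr mat2_scaleDl.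

Definition traceless_pred : {pred mat2 K} :=
  fun N => \tr (N : 'M[K]_2) == 0.

Lemma traceless_submod_closed : submod_closed traceless_pred.
Proof.
split=> [|a M N]; rewrite !unfold_in; first exact/eqP/mxtrace0.
move=> /eqP hM /eqP hN; apply/eqP.
transitivity (a *: \tr (M : 'M[K]_2) + \tr (N : 'M[K]_2)).
  rewrite scaler_sumr -big_split; apply: eq_bigr => i _; rewrite !mxE //.
by rewrite hM hN scaler0 addr0.
Qed.

HB.instance Definition _ :=
  GRing.isSubmodClosed.Build R (mat2 K) traceless_pred traceless_submod_closed.

Record traceless : Type :=
  Traceless { traceless_mx :> mat2 K; _ : traceless_mx \in traceless_pred }.

HB.instance Definition _ := [isSub for traceless_mx].
HB.instance Definition _ := [Choice of traceless by <:].
HB.instance Definition _ := [SubChoice_isSubLmodule of traceless by <:].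

End Mat2.

Section RealComplex.
Variable R : realType.

Definition sl2R := traceless R^o.

Lemma sl2R_commutator (M N : sl2R) :
  mxcommutator (M : 'M[R]_2) N \in traceless_pred (K := R^o).
Proof. by rewrite unfold_in raddfB /= mxtrace_mulC subrr. Qed.

Definition sl2R_bracket (M N : sl2R) : sl2R := Traceless (sl2R_commutator M N).

Definition phiR (N : sl2R) : 'M[R]_3 :=
  let N : 'M[R]_2 := N in
  let a := N 0 0 in let b := N 0 1 in let c := N 1 0 in
  matrix_of_rows 3
    [:: [:: 0;     b + c; 2 * a];
        [:: b + c; 0;     c - b];
        [:: 2 * a; b - c; 0]].

(* Rcomplex R is R[i] seen as a real algebra. *)
Definition sl2C := traceless (Rcomplex R).

Lemma sl2C_commutator (M N : sl2C) :
  mxcommutator (M : 'M[Rcomplex R]_2) N \in traceless_pred (K := Rcomplex R).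
Proof. by rewrite unfold_in raddfB /= mxtrace_mulC subrr. Qed.

Definition sl2C_bracket (M N : sl2C) : sl2C := Traceless (sl2C_commutator M N).

Definition phiC (N : sl2C) : 'M[R]_4 :=
  let N : 'M[Rcomplex R]_2 := N in
  let a0 := complex.Re (N 0 0) in let a1 := complex.Im (N 0 0) in
  let b0 := complex.Re (N 0 1) in let b1 := complex.Im (N 0 1) in
  let c0 := complex.Re (N 1 0) in let c1 := complex.Im (N 1 0) in
  matrix_of_rows 4
    [:: [:: 0;       b0 + c0; b1 - c1;    2 * a0];
        [:: c0 + b0; 0;       - (2 * a1); c0 - b0];
        [:: b1 - c1; 2 * a1;  0;          - b1 - c1];
        [:: 2 * a0;  b0 - c0; b1 + c1;    0]].

End RealComplex.

(* Quaternions: q 0 0, q 0 1, q 0 2, q 0 3 are the coordinates in 1, i, j, k. *)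
Definition quat (R : realType) : Type := 'rV[R]_4.

Section Quaternions.
Variable R : realType.

HB.instance Definition _ := GRing.Lmodule.copy (quat R) 'rV[R]_4.

Definition Quat (x0 x1 x2 x3 : R) : quat R :=
  \row_i nth 0 [:: x0; x1; x2; x3] i.

Definition quat_one : quat R := Quat 1 0 0 0.

Definition quat_mul (p q : quat R) : quat R :=
  Quat (p 0 0 * q 0 0 - p 0 1 * q 0 1 - p 0 2 * q 0 2 - p 0 3 * q 0 3)
       (p 0 0 * q 0 1 + p 0 1 * q 0 0 + p 0 2 * q 0 3 - p 0 3 * q 0 2)
       (p 0 0 * q 0 2 - p 0 1 * q 0 3 + p 0 2 * q 0 0 + p 0 3 * q 0 1)
       (p 0 0 * q 0 3 + p 0 1 * q 0 2 - p 0 2 * q 0 1 + p 0 3 * q 0 0).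

Definition quat_conj (q : quat R) : quat R :=
  Quat (q 0 0) (- q 0 1) (- q 0 2) (- q 0 3).

Lemma QuatE x0 x1 x2 x3 : (Quat x0 x1 x2 x3 0 0 = x0) *
  (Quat x0 x1 x2 x3 0 1 = x1) * (Quat x0 x1 x2 x3 0 2 = x2) *
  (Quat x0 x1 x2 x3 0 3 = x3).
Proof. by rewrite !mxE. Qed.

Lemma quatP (p q : quat R) : p 0 0 = q 0 0 -> p 0 1 = q 0 1 ->
  p 0 2 = q 0 2 -> p 0 3 = q 0 3 -> p = q.
Proof.
move=> h0 h1 h2 h3; apply/rowP; case=> [[|[|[|[|//]]]] hi].
- by rewrite (_ : Ordinal hi = 0) //; apply/val_inj.
- by rewrite (_ : Ordinal hi = 1) //; apply/val_inj.
- by rewrite (_ : Ordinal hi = 2) //; apply/val_inj.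
- by rewrite (_ : Ordinal hi = 3) //; apply/val_inj.
Qed.

Lemma quat_addE (p q : quat R) i : (p + q) 0 i = p 0 i + q 0 i.
Proof. exact: mxE. Qed.

Lemma quat_oppE (p : quat R) i : (- p) 0 i = - p 0 i.
Proof. exact: mxE. Qed.

Lemma quat_scaleE a (p : quat R) i : (a *: p) 0 i = a * p 0 i.
Proof. exact: mxE. Qed.

Fact quat_mulA : associative quat_mul.
Proof. by move=> p q r; apply: quatP; rewrite !QuatE; ring. Qed.

Fact quat_mul1 : left_id quat_one quat_mul.
Proof. by move=> p; apply: quatP; rewrite !QuatE; ring. Qed.

Fact quat_mulr1 : right_id quat_one quat_mul.
Proof. by move=> p; apply: quatP; rewrite !QuatE; ring. Qed.

Fact quat_mulDl : left_distributive quat_mul +%R.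
Proof. by move=> p q r; apply: quatP; rewrite !(QuatE, quat_addE); ring. Qed.

Fact quat_mulDr : right_distributive quat_mul +%R.
Proof. by move=> p q r; apply: quatP; rewrite !(QuatE, quat_addE); ring. Qed.

Fact quat_one_neq0 : quat_one != 0.
Proof.
apply/eqP=> /(congr1 (fun q : quat R => q 0 0)); rewrite QuatE mxE.
by move/eqP; rewrite oner_eq0.
Qed.

HB.instance Definition _ := GRing.Zmodule_isNzRing.Build (quat R)
  quat_mulA quat_mul1 quat_mulr1 quat_mulDl quat_mulDr quat_one_neq0.

Definition sl2H_pred : {pred mat2 (quat R)} :=
  fun N => (\tr (N : 'M[quat R]_2)) 0 0 == 0.

Lemma sl2H_submod_closed : submod_closed sl2H_pred.
Proof.
split=> [|a M N]; rewrite !unfold_in /mxtrace !big_ord_recl !big_ord0 !addr0.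
  by rewrite !mxE addr0.
rewrite !quat_addE => /eqP hM /eqP hN; apply/eqP.
transitivity (a * (M ord0 ord0 0 0 + M (lift ord0 ord0) (lift ord0 ord0) 0 0) +
  (N ord0 ord0 0 0 + N (lift ord0 ord0) (lift ord0 ord0) 0 0)).
  by rewrite !mxE; ring.
by rewrite hM hN mulr0 addr0.
Qed.

HB.instance Definition _ :=
  GRing.isSubmodClosed.Build R (mat2 (quat R)) sl2H_pred sl2H_submod_closed.

Record sl2H : Type :=
  Sl2H { sl2H_mx :> mat2 (quat R); _ : sl2H_mx \in sl2H_pred }.

HB.instance Definition _ := [isSub for sl2H_mx].
HB.instance Definition _ := [Choice of sl2H by <:].
HB.instance Definition _ := [SubChoice_isSubLmodule of sl2H by <:].

Lemma sl2H_commutator (M N : sl2H) :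
  mxcommutator (M : 'M[quat R]_2) N \in sl2H_pred.
Proof.
rewrite unfold_in /mxcommutator raddfB /=.
have reB (p q : quat R) : (p - q) 0 0 = p 0 0 - q 0 0 by rewrite !mxE.
have reM (p q : quat R) : (p * q) 0 0 = (q * p) 0 0 by rewrite !QuatE; ring.
rewrite reB subr_eq0 /mxtrace !big_ord_recl !big_ord0 !addr0 !quat_addE.
rewrite ![((_ : 'M_2) *m _) _ _]mxE !big_ord_recl !big_ord0 !addr0 !quat_addE.
rewrite [X in X + _ + _ == _]reM [X in _ + X + _ == _]reM.
rewrite [X in _ + (X + _) == _]reM [X in _ + (_ + X) == _]reM.
by apply/eqP; ring.
Qed.

Definition sl2H_bracket (M N : sl2H) : sl2H := Sl2H (sl2H_commutator M N).

Definition phiH (N : sl2H) : 'M[R]_6 :=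
  let N : 'M[quat R]_2 := N in
  let a0 := N 0 0 0 0 in let a1 := N 0 0 0 1 in
  let a2 := N 0 0 0 2 in let a3 := N 0 0 0 3 in
  let b0 := N 0 1 0 0 in let b1 := N 0 1 0 1 in
  let b2 := N 0 1 0 2 in let b3 := N 0 1 0 3 in
  let c0 := N 1 0 0 0 in let c1 := N 1 0 0 1 in
  let c2 := N 1 0 0 2 in let c3 := N 1 0 0 3 in
  let d1 := N 1 1 0 1 in let d2 := N 1 1 0 2 in let d3 := N 1 1 0 3 in
  matrix_of_rows 6
    [:: [:: 0; b0 + c0; b1 - c1; b2 - c2; b3 - c3; 2 * a0];
        [:: b0 + c0; 0; d1 - a1; d2 - a2; d3 - a3; c0 - b0];
        [:: b1 - c1; a1 - d1; 0; - (a3 + d3); a2 + d2; - (b1 + c1)];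
        [:: b2 - c2; a2 - d2; a3 + d3; 0; - (a1 + d1); - (b2 + c2)];
        [:: b3 - c3; a3 - d3; - (a2 + d2); a1 + d1; 0; - (b3 + c3)];
        [:: 2 * a0; b0 - c0; b1 + c1; b2 + c2; b3 + c3; 0]].

End Quaternions.

(* Octonions: x 0 i is the coordinate of x in e_i. *)
Definition oct (R : realType) : Type := 'rV[R]_8.

Section Octonions.
Variable R : realType.

HB.instance Definition _ := Vector.copy (oct R) 'rV[R]_8.

Definition oct_fst (x : oct R) : quat R := lsubmx (x : 'rV[R]_(4 + 4)).
Definition oct_snd (x : oct R) : quat R := rsubmx (x : 'rV[R]_(4 + 4)).
Definition Oct (p q : quat R) : oct R := row_mx (p : 'rV[R]_4) (q : 'rV[R]_4).

(* Cayley-Dickson doubling, (p, q)(r, s) = (p r - s^* q, s p + q r^* ), so    *)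
(* that e_1, e_2, e_3 = i, j, k and                                           *)
(*   e1 e2 = e3, e1 e4 = e5, e1 e7 = e6, e2 e4 = e6,                          *)
(*   e2 e5 = e7, e3 e4 = e7, e3 e6 = e5.                                      *)
Definition oct_mul (x y : oct R) : oct R :=
  let p := oct_fst x in let q := oct_snd x in
  let r := oct_fst y in let s := oct_snd y in
  Oct (p * r - quat_conj s * q) (s * p + q * quat_conj r).

Definition oct_e (i : 'I_8) : oct R := delta_mx 0 i.

Definition oct_comm (d x : oct R) : oct R := oct_mul d x - oct_mul x d.

Definition C_pred : {pred 'End(oct R)} := fun f =>
  `[< exists d : oct R, d 0 0 = 0 /\ forall x, f x = oct_comm d x >].

Definition Der_pred : {pred 'End(oct R)} := fun f =>
  `[< forall x y, f (oct_mul x y) = oct_mul (f x) y + oct_mul x (f y) >].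

Lemma oct_mulP a (x y z : oct R) :
  (oct_mul (a *: x + y) z = a *: oct_mul x z + oct_mul y z) *
  (oct_mul z (a *: x + y) = a *: oct_mul z x + oct_mul z y).
Proof.
have EP (p q p' q' : quat R) :
    a *: Oct p q + Oct p' q' = Oct (a *: p + p') (a *: q + q').
  transitivity (a *: row_mx (p : 'rV[R]_4) (q : 'rV[R]_4) +
    row_mx (p' : 'rV[R]_4) (q' : 'rV[R]_4) : 'rV[R]_(4 + 4)) => //.
  by rewrite scale_row_mx add_row_mx.
have fP (u v : oct R) : oct_fst (a *: u + v) = a *: oct_fst u + oct_fst v.
  by rewrite /oct_fst; apply/rowP=> i; rewrite !mxE.
have sP (u v : oct R) : oct_snd (a *: u + v) = a *: oct_snd u + oct_snd v.
  by rewrite /oct_snd; apply/rowP=> i; rewrite !mxE.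
split; rewrite /oct_mul EP !fP !sP; congr Oct; apply: quatP;
  by rewrite !(quat_addE, quat_oppE, quat_scaleE, QuatE); ring.
Qed.

Lemma oct_mul0 (x : oct R) : (oct_mul 0 x = 0) * (oct_mul x 0 = 0).
Proof.
have [h1 h2] := oct_mulP (-1) 0 0 x.
by move: h1 h2; rewrite scaler0 addr0 !scaleN1r !addNr.
Qed.

Lemma C_submod_closed : submod_closed C_pred.
Proof.
split=> [|a f g]; rewrite !unfold_in.
  apply/asboolP; exists 0; split=> [|x]; first by rewrite mxE.
  by rewrite /oct_comm !oct_mul0 subr0 lfunE.
move=> /asboolP[d [d0 hd]] /asboolP[e [e0 he]]; apply/asboolP.
exists (a *: d + e); split=> [|x]; first by rewrite !mxE d0 e0 mulr0 addr0.
by rewrite !lfunE /= lfunE /= hd he /oct_comm !oct_mulP scalerBr opprD addrACA.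
Qed.

Lemma Der_submod_closed : submod_closed Der_pred.
Proof.
split=> [|a f g]; rewrite !unfold_in.
  apply/asboolP=> x y; rewrite !lfunE /=.
  by rewrite !oct_mul0 addr0.
move=> /asboolP hf /asboolP hg; apply/asboolP=> x y.
by rewrite !lfunE /= !lfunE /= hf hg !oct_mulP scalerDr addrACA.
Qed.

HB.instance Definition _ :=
  GRing.isSubmodClosed.Build R 'End(oct R) C_pred C_submod_closed.
HB.instance Definition _ :=
  GRing.isSubmodClosed.Build R 'End(oct R) Der_pred Der_submod_closed.

Record C_octonions : Type :=
  COctonions { C_lfun :> 'End(oct R); _ : C_lfun \in C_pred }.

HB.instance Definition _ := [isSub for C_lfun].
HB.instance Definition _ := [Choice of C_octonions by <:].
HB.instance Definition _ := [SubChoice_isSubLmodule of C_octonions by <:].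

Record Der_octonions : Type :=
  DerOctonions { Der_lfun :> 'End(oct R); _ : Der_lfun \in Der_pred }.

HB.instance Definition _ := [isSub for Der_lfun].
HB.instance Definition _ := [Choice of Der_octonions by <:].
HB.instance Definition _ := [SubChoice_isSubLmodule of Der_octonions by <:].

Definition sl2O : Type :=
  (traceless (oct R) * C_octonions * Der_octonions)%type.

HB.instance Definition _ := GRing.Lmodule.copy sl2O
  (traceless (oct R) * C_octonions * Der_octonions)%type.

Definition oct_vec (x : oct R) : 'cV[R]_7 := \col_i x 0 (lift ord0 i).

Definition phiO_mx (N : traceless (oct R)) : 'M[R]_10 :=
  let N : 'M[oct R]_2 := N in
  let a0 := N 0 0 0 0 in let a := oct_vec (N 0 0) in
  let b0 := N 0 1 0 0 in let b := oct_vec (N 0 1) in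
  let c0 := N 1 0 0 0 in let c := oct_vec (N 1 0) in
  let row4 p (x : 'M_(p, 1)) (y : 'M_(p, 1)) (z : 'M_(p, 7)) (t : 'M_(p, 1)) :
    'M[R]_(p, 1 + (1 + (7 + 1))) := row_mx x (row_mx y (row_mx z t)) in
  col_mx   (row4 1 0             (b0 + c0)%:M  (b - c)^T       (2 * a0)%:M)
  (col_mx  (row4 1 (b0 + c0)%:M  0             (- (2 *: a)^T)  (c0 - b0)%:M)
  (col_mx  (row4 7 (b - c)       (2 *: a)      0               (- (b + c)))
           (row4 1 (2 * a0)%:M   (b0 - c0)%:M  (b + c)^T       0))).

(* For f : O -> O with f(O') in O', diag(0, 0, A, 0) with A the matrix of f   *)
(* on O' in e_1, ..., e_7; column j of A holds the coordinates of f e_(j+1).  *)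
Definition phiO_end (f : 'End(oct R)) : 'M[R]_10 :=
  let A : 'M[R]_7 :=
    \matrix_(i, j) (f (oct_e (lift ord0 j)) : oct R) 0 (lift ord0 i) in
  (block_mx (0 : 'M_1) 0 0 (block_mx (0 : 'M_1) 0 0 (block_mx A 0 0 (0 : 'M_1)))
    : 'M_(1 + (1 + (7 + 1)))).

Definition phiO (M : sl2O) : 'M[R]_10 :=
  phiO_mx M.1.1 + phiO_end M.1.2 + phiO_end M.2.

(* phiO^-1 (phiO M * phiO N - phiO N * phiO M); xget returns 0 when there is  *)
(* no preimage.                                                               *)
Definition sl2O_bracket (M N : sl2O) : sl2O :=
  xget 0 [set P : sl2O | phiO P = mxcommutator (phiO M) (phiO N)]%classic.

End Octonions.

(* Main.v *)
(* An injective linear map into a Lie algebra that is compatible with the     *)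
(* brackets transports the Lie axioms back, so only so(m,1) has to be shown   *)
(* to be a Lie algebra.  For K = R, C, H compatibility is an identity between *)
(* explicit matrices; both sides lie in so(m,1), hence it suffices to compare *)
(* the entries above the diagonal.  For K = O the bracket is defined through  *)
(* phi, and what has to be shown is that phi is bijective, that is,           *)
(* so(7) = C(O') + Der(O) is a direct sum.  Commutators and derivations kill  *)
(* 1 and are skew.  A skew map S of O' is a derivation exactly when it        *)
(* satisfies seven linear equations, one for each e_k; on the space C(O')     *)
(* these equations are nondegenerate (C_d takes the k-th one to a multiple of *)
(* d_k), so S - C_d is a derivation for a unique d.                           *)

From HB Require Import structures.
Require Import Defs.
From mathcomp Require Import all_boot all_order all_algebra.
From mathcomp Require Import all_classical all_reals.
From mathcomp Require Import complex ring lra.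

Set Implicit Arguments.
Unset Strict Implicit.
Unset Printing Implicit Defensive.

Import Order.TTheory GRing.Theory Num.Theory.
Local Open Scope ring_scope.

(** The determinant of a hermitian [X] is the Minkowski form, and each map phi is the action of
    sl(2,K) on such [X] written in coordinates; the proof works on the explicit matrices. All four
    cases pass through [matrix_so_isomorphism]: a linear map with zero kernel and image so(m,1) that
    turns the bracket into the commutator is a Lie isomorphism. By [so_eq], elements of so(m,1) are
    compared above the diagonal. For R, C, H those entries are independent linear forms in the free
    coordinates of N, so kernel and preimages come from small linear systems and the bracket from
    polynomial identities.

    For O, the entries outside the middle 7x7 block recover N in the same way, and the block itself
    must be an arbitrary skew matrix: 21 = 7 + 14. For imaginary x, y the element xy + yx is real,
    and a derivation kills 1, so derivations are skew ([derivation_skew]). The Leibniz defect of C_d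
    at (x, y) is -3 times the associator of d, x, y, so C_d is a derivation only for d = 0
    ([C_derivation_eq0]), which gives injectivity ([C_Der_inj]). A skew map killing 1 and orthogonal
    to all C_(e_k) is a derivation ([skew_derivation]), so subtracting from a skew matrix its
    projection to C(O') leaves a derivation ([skew_decomposition]). *)

(** * Lie brackets and the common frame of the four cases *)

Lemma lie_bracket_pullback (R : pzRingType) (L L' : lmodType R)
    (br : L -> L -> L) (br' : L' -> L' -> L') (f : L -> L') :
  linear f -> injective f -> (forall x y, f (br x y) = br' (f x) (f y)) ->
  is_lie_bracket br' -> is_lie_bracket br.
Proof.
move=> flin finj fbr [brl brr bralt brjac].
have f0 : f 0 = 0.
  by have := flin (-1) 0 0; rewrite scaler0 addr0 scaleN1r addNr.
have fD x y : f (x + y) = f x + f y by have := flin 1 x y; rewrite !scale1r.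
split.
- by move=> y a u v; apply: finj; rewrite flin !fbr flin brl.
- by move=> x a u v; apply: finj; rewrite flin !fbr flin brr.
- by move=> x; apply: finj; rewrite fbr f0 bralt.
- by move=> x y z; apply: finj; rewrite !fD !fbr f0 brjac.
Qed.

Lemma mxcommutator_lie (R : comPzRingType) n :
  is_lie_bracket (@mxcommutator R n).
Proof.
split.
- move=> y a u v; rewrite /mxcommutator mulmxDl mulmxDr -scalemxAl -scalemxAr.
  by rewrite scalerBr opprD addrACA.
- move=> y a u v; rewrite /mxcommutator mulmxDl mulmxDr -scalemxAl -scalemxAr.
  by rewrite scalerBr opprD addrACA.
- by move=> x; rewrite /mxcommutator subrr.
- move=> x y z; rewrite /mxcommutator !(mulmxBl, mulmxBr) !mulmxA !opprB.
  by apply/matrixP=> i j; rewrite !mxE; ring.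
Qed.

Lemma so_bracket_lie (R : realType) m : is_lie_bracket (@so_bracket R m).
Proof.
apply: (@lie_bracket_pullback _ _ _ _ _ (@so_mx R m) _ _ _
  (mxcommutator_lie R m.+1)) => //.
exact: val_inj.
Qed.

Lemma matrix_so_isomorphism (R : realType) m (L : lmodType R)
    (br : L -> L -> L) (phi : L -> 'M[R]_m.+1) :
  linear phi -> (forall x, (forall i j, phi x i j = 0) -> x = 0) ->
  (forall x, phi x \in @so_pred R m) ->
  (forall w, w \in @so_pred R m -> exists x, phi x = w) ->
  (forall x y, phi (br x y) = mxcommutator (phi x) (phi y)) ->
  exists f : L -> so R m, [/\ forall x, f x = phi x :> 'M[R]_m.+1,
    linear f, bijective f & is_lie_isomorphism br (@so_bracket R m) f].
Proof.
move=> philin phi0 phiso phisur phibr.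
pose f x := So (phiso x); exists f.
have flin : linear f by move=> a x y; apply: val_inj; rewrite linearP /= philin.
have finj : injective f.
  move=> x y /(congr1 (@so_mx _ _)) /= e; apply/eqP; rewrite -subr_eq0.
  apply/eqP/phi0 => i j; have := philin (-1) y x.
  by rewrite !scaleN1r e addNr addrC => ->; rewrite mxE.
have fbr x y : f (br x y) = so_bracket (f x) (f y).
  by apply: val_inj; exact: phibr.
(* Surjectivity is only an existence statement; [cid] chooses the preimages that make up the
   inverse. *)
have [g gK] : {g | forall w : so R m, f (g w) = w}.
  have h (w : so R m) : {x | f x = w}.
    have /cid[x hx] := phisur w (valP w).
    by exists x; apply: val_inj.
  by exists (fun w => sval (h w)) => w; exact: (svalP (h w)).
have fbij : bijective f by exists g => // x; apply: finj; rewrite gK.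
split=> //; split=> //; last exact: so_bracket_lie.
exact: lie_bracket_pullback flin finj fbr (@so_bracket_lie R m).
Qed.

(** * so(m,1) entry by entry *)

Section MinkowskiSigns.
Variable R : realType.

Definition msign n (i : 'I_n.+1) : R := if i == 0 then 1 else -1.

Lemma so_predP m (w : 'M[R]_m.+1) :
  reflect (forall i j, msign i * w i j = - (msign j * w j i))
    (w \in @so_pred R m).
Proof.
have E i j : (minkowski R m *m w) i j = msign i * w i j.
  by rewrite mul_diag_mx !mxE.
apply: (iffP eqP) => [h i j|h].
  by rewrite -!E [in LHS]h 2!mxE.
apply/matrixP=> i j; rewrite [RHS]mxE [in RHS]mxE !E; exact: h.
Qed.

(** The sign rule determines each entry below the diagonal from its mirror image and makes each
    diagonal entry its own negative. *)
Lemma so_eq m (u w : 'M[R]_m.+1) :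
  u \in @so_pred R m -> w \in @so_pred R m ->
  (forall i j : 'I_m.+1, (i < j)%N -> u i j = w i j) -> u = w.
Proof.
move=> /so_predP hu /so_predP hw h.
have sign_neq0 (i : 'I_m.+1) : msign i != 0.
  by rewrite /msign; case: ifP; rewrite ?oppr_eq0 oner_eq0.
apply/matrixP=> i j; case: (ltngtP i j) => [/h //|/h e|/val_inj <-].
  by apply: (mulfI (sign_neq0 i)); rewrite hu e -hw.
have diag0 (v : 'M[R]_m.+1) :
    msign i * v i i = - (msign i * v i i) -> v i i = 0.
  move=> /eqP; rewrite -addr_eq0 -mulr2n mulrn_eq0 /= mulf_eq0.
  by rewrite (negPf (sign_neq0 i)) /= => /eqP.
by rewrite (diag0 u (hu i i)) (diag0 w (hw i i)).
Qed.

Lemma mxcommutator_so m (u w : 'M[R]_m.+1) :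
  u \in @so_pred R m -> w \in @so_pred R m ->
  mxcommutator u w \in @so_pred R m.
Proof. by move=> hu hw; exact: (so_commutator (So hu) (So hw)). Qed.

End MinkowskiSigns.

(** * Explicit indices and entries of 2x2 matrices *)

Lemma ord_numeral n k (hk : (k < n.+2)%N) : Ordinal hk = k%:R.
Proof. by apply: val_inj; rewrite Zp_nat /= modn_small. Qed.

Lemma ord2P (P : 'I_2 -> Prop) : P 0 -> P 1 -> forall i, P i.
Proof.
by move=> h0 h1; case=> [[|[|//]] hi]; rewrite ord_numeral.
Qed.

Lemma ord3P (P : 'I_3 -> Prop) : P 0 -> P 1 -> P 2 -> forall i, P i.
Proof.
by move=> h0 h1 h2; case=> [[|[|[|//]]] hi]; rewrite ord_numeral.
Qed.

Lemma ord4P (P : 'I_4 -> Prop) :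
  P 0 -> P 1 -> P 2 -> P 3 -> forall i, P i.
Proof.
by move=> h0 h1 h2 h3; case=> [[|[|[|[|//]]]] hi]; rewrite ord_numeral.
Qed.

Lemma ord6P (P : 'I_6 -> Prop) :
  P 0 -> P 1 -> P 2 -> P 3 -> P 4 -> P 5 -> forall i, P i.
Proof.
by move=> h0 h1 h2 h3 h4 h5;
  case=> [[|[|[|[|[|[|//]]]]]] hi]; rewrite ord_numeral.
Qed.

Lemma matrix_of_rowsE (K : nmodType) n (s : seq (seq K)) i j :
  matrix_of_rows n s i j = nth 0 (nth [::] s i) j.
Proof. exact: mxE. Qed.

Lemma mxcommutatorE (K : pzRingType) n (A B : 'M[K]_n) i j :
  mxcommutator A B i j = \sum_k (A i k * B k j - B i k * A k j).
Proof. by rewrite !mxE -sumrB. Qed.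

Lemma mx_linE (K : pzRingType) m n a (A B : 'M[K]_(m, n)) i j :
  (a *: A + B) i j = a * A i j + B i j.
Proof. by rewrite !mxE. Qed.

Lemma sum2 (V : nmodType) (F : 'I_2 -> V) : \sum_(i < 2) F i = F 0 + F 1.
Proof.
rewrite !big_ord_recl big_ord0 addr0.
by congr (_ + F _); apply: val_inj.
Qed.

Lemma mxcommutator2E (K : pzRingType) (M N : 'M[K]_2) i j :
  mxcommutator M N i j =
  M i 0 * N 0 j + M i 1 * N 1 j - (N i 0 * M 0 j + N i 1 * M 1 j).
Proof. by rewrite !mxE !sum2. Qed.

Section TracelessEntries.
Variables (R : realType) (K : lmodType R).

Lemma mat2_linE a (M N : mat2 K) i j :
  (a *: M + N : mat2 K) i j = a *: M i j + N i j.
Proof. by rewrite !mxE. Qed.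

Lemma traceless11 (x : traceless K) : x 1 1 = - x 0 0.
Proof.
have := valP x; rewrite unfold_in /mxtrace sum2 addrC addr_eq0 => /eqP; exact.
Qed.

Lemma traceless_eq0 (x : traceless K) :
  x 0 0 = 0 -> x 0 1 = 0 -> x 1 0 = 0 -> x = 0.
Proof.
move=> h00 h01 h10; apply/val_inj/matrixP.
by apply: ord2P; apply: ord2P; rewrite [RHS]mxE ?h00 ?h01 ?h10 //
  traceless11 h00 oppr0.
Qed.

Lemma traceless_of_entries (a b c : K) :
  {x : traceless K | [/\ x 0 0 = a, x 0 1 = b & x 1 0 = c]}.
Proof.
pose N : mat2 K := matrix_of_rows 2 [:: [:: a; b]; [:: c; - a]].
have hN : N \in traceless_pred (K := K).
  by rewrite unfold_in /mxtrace sum2 !mxE /= addrN.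
by exists (Traceless hN); split; rewrite mxE.
Qed.

End TracelessEntries.

(** * The cases R, C and H *)

Section AssociativeCases.
Variable R : realType.

Lemma phiR_isomorphism : exists f : sl2R R -> so R 2,
  [/\ forall N, f N = phiR N :> 'M[R]_3, linear f, bijective f &
    is_lie_isomorphism (@sl2R_bracket R) (@so_bracket R 2) f].
Proof.
have phiso (x : sl2R R) : phiR x \in @so_pred R 2.
  by apply/so_predP; apply: ord3P; apply: ord3P;
    rewrite /msign !matrix_of_rowsE /=; ring.
have scaleE (a b : R) : a *: (b : R^o) = a * b by [].
apply: matrix_so_isomorphism => // [a x y|x h|w hw|x y].
- apply/matrixP=> i j; rewrite mx_linE !matrix_of_rowsE /=.
  rewrite !(mat2_linE (K := R^o)) !scaleE.
  by move: i j; apply: ord3P; apply: ord3P => /=; ring.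
- move: (h 0 1) (h 0 2) (h 1 2); rewrite !matrix_of_rowsE /= => h01 h02 h12.
  by apply: traceless_eq0; lra.
(* The solution of 2a = w02, b + c = w01, c - b = w12. *)
- have [x [xa xb xc]] := traceless_of_entries (K := R^o)
    (w 0 2 / 2) ((w 0 1 - w 1 2) / 2) ((w 0 1 + w 1 2) / 2).
  exists x; apply: so_eq => //.
  by apply: ord3P; apply: ord3P => // _;
    rewrite matrix_of_rowsE /= ?xa ?xb ?xc; field.
- apply: so_eq => // [|i j]; first exact: mxcommutator_so.
  rewrite mxcommutatorE !big_ord_recl big_ord0 !matrix_of_rowsE /=.
  rewrite !mxcommutator2E !(traceless11 (K := R^o)).
  by move: i j; apply: ord3P; apply: ord3P => //= _; ring.
Qed.

Lemma ReM (u v : Rcomplex R) : complex.Re (u * v) =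
  complex.Re u * complex.Re v - complex.Im u * complex.Im v.
Proof. by case: u v => ? ? [? ?]. Qed.

Lemma ImM (u v : Rcomplex R) : complex.Im (u * v) =
  complex.Re u * complex.Im v + complex.Im u * complex.Re v.
Proof. by case: u v => ? ? [? ?]. Qed.

Lemma ReD (u v : Rcomplex R) : complex.Re (u + v) = complex.Re u + complex.Re v.
Proof. by case: u v => ? ? [? ?]. Qed.

Lemma ImD (u v : Rcomplex R) : complex.Im (u + v) = complex.Im u + complex.Im v.
Proof. by case: u v => ? ? [? ?]. Qed.

Lemma ReN (u : Rcomplex R) : complex.Re (- u) = - complex.Re u.
Proof. by case: u. Qed.

Lemma ImN (u : Rcomplex R) : complex.Im (- u) = - complex.Im u.
Proof. by case: u. Qed.

Lemma ReZ a (u : Rcomplex R) : complex.Re (a *: u) = a * complex.Re u.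
Proof. by case: u. Qed.

Lemma ImZ a (u : Rcomplex R) : complex.Im (a *: u) = a * complex.Im u.
Proof. by case: u. Qed.

Let ReImE := (ReD, ImD, ReN, ImN, ReM, ImM, ReZ, ImZ).

Lemma phiC_isomorphism : exists f : sl2C R -> so R 3,
  [/\ forall N, f N = phiC N :> 'M[R]_4, linear f, bijective f &
    is_lie_isomorphism (@sl2C_bracket R) (@so_bracket R 3) f].
Proof.
have phiso (x : sl2C R) : phiC x \in @so_pred R 3.
  by apply/so_predP; apply: ord4P; apply: ord4P;
    rewrite /msign !matrix_of_rowsE /=; ring.
apply: matrix_so_isomorphism => // [a x y|x h|w hw|x y].
- apply/matrixP=> i j; rewrite mx_linE !matrix_of_rowsE /=.
  rewrite !(mat2_linE (K := Rcomplex R)) !ReImE.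
  by move: i j; apply: ord4P; apply: ord4P => /=; ring.
- move: (h 0 1) (h 0 2) (h 0 3) (h 1 2) (h 1 3) (h 2 3).
  rewrite !matrix_of_rowsE /= => h01 h02 h03 h12 h13 h23.
  by apply: traceless_eq0; apply/eqP; rewrite eq_complex /=; apply/andP;
    split; apply/eqP; lra.
(* Half sums and differences: b0 and c0 from w01, w13; b1 and c1 from w02, w23. *)
- have [x [xa xb xc]] := traceless_of_entries (K := Rcomplex R)
    (Complex (w 0 3 / 2) (- w 1 2 / 2))
    (Complex ((w 0 1 - w 1 3) / 2) ((w 0 2 - w 2 3) / 2))
    (Complex ((w 0 1 + w 1 3) / 2) ((- w 0 2 - w 2 3) / 2)).
  exists x; apply: so_eq => //.
  by apply: ord4P; apply: ord4P => // _;
    rewrite matrix_of_rowsE /= ?xa ?xb ?xc /=; field.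
- apply: so_eq => // [|i j]; first exact: mxcommutator_so.
  rewrite mxcommutatorE !big_ord_recl big_ord0 !matrix_of_rowsE.
  move: i j; apply: ord4P; apply: ord4P => //= _;
    by rewrite !mxcommutator2E ?(traceless11 (K := Rcomplex R)) !ReImE; ring.
Qed.

Lemma quatM_E (p q : quat R) :
  ((p * q) 0 0 =
     p 0 0 * q 0 0 - p 0 1 * q 0 1 - p 0 2 * q 0 2 - p 0 3 * q 0 3) *
  ((p * q) 0 1 =
     p 0 0 * q 0 1 + p 0 1 * q 0 0 + p 0 2 * q 0 3 - p 0 3 * q 0 2) *
  ((p * q) 0 2 =
     p 0 0 * q 0 2 - p 0 1 * q 0 3 + p 0 2 * q 0 0 + p 0 3 * q 0 1) *
  ((p * q) 0 3 =
     p 0 0 * q 0 3 + p 0 1 * q 0 2 - p 0 2 * q 0 1 + p 0 3 * q 0 0).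
Proof. by rewrite !QuatE. Qed.

Let quatE := (quat_addE, quat_oppE, quat_scaleE, quatM_E).

Lemma quat_commutatorE (M N : 'M[quat R]_2) i j k :
  mxcommutator M N i j 0 k =
  (M i 0 * N 0 j) 0 k + (M i 1 * N 1 j) 0 k -
  ((N i 0 * M 0 j) 0 k + (N i 1 * M 1 j) 0 k).
Proof. by rewrite mxcommutator2E quat_addE quat_oppE !quat_addE. Qed.

Lemma sl2H_re11 (x : sl2H R) : x 1 1 0 0 = - x 0 0 0 0.
Proof.
have := valP x; rewrite unfold_in /mxtrace sum2 quat_addE addrC addr_eq0.
by move=> /eqP; exact.
Qed.

Lemma phiH_isomorphism : exists f : sl2H R -> so R 5,
  [/\ forall N, f N = phiH N :> 'M[R]_6, linear f, bijective f &
    is_lie_isomorphism (@sl2H_bracket R) (@so_bracket R 5) f].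
Proof.
have phiso (x : sl2H R) : phiH x \in @so_pred R 5.
  by apply/so_predP; apply: ord6P; apply: ord6P;
    rewrite /msign !matrix_of_rowsE /=; ring.
apply: matrix_so_isomorphism => // [a x y|x h|w hw|x y].
- apply/matrixP=> i j; rewrite mx_linE !matrix_of_rowsE /=.
  rewrite !(mat2_linE (K := quat R)) !quatE.
  by move: i j; apply: ord6P; apply: ord6P => /=; ring.
(* Fifteen entries above the diagonal for the fifteen free coordinates of [x]. *)
- have := (h 0 1, h 0 2, h 0 3, h 0 4, h 0 5, h 1 2, h 1 3, h 1 4).
  have := (h 1 5, h 2 3, h 2 4, h 2 5, h 3 4, h 3 5, h 4 5).
  rewrite !matrix_of_rowsE /= => -[[[[[[h15 h23] h24] h25] h34] h35] h45].
  move=> [[[[[[[h01 h02] h03] h04] h05] h12] h13] h14].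
  apply/val_inj/matrixP.
  by apply: ord2P; apply: ord2P; apply: quatP; rewrite /= ?sl2H_re11 !mxE; lra.
(* Row 1 of [w] gives the imaginary part of delta - alpha, the block of rows and columns 2 to 4 that
   of alpha + delta; the real parts of alpha and delta are opposite. *)
- pose N : mat2 (quat R) := matrix_of_rows 2
    [:: [:: Quat (w 0 5 / 2) ((- w 1 2 - w 3 4) / 2)
              ((- w 1 3 + w 2 4) / 2) ((- w 1 4 - w 2 3) / 2);
            Quat ((w 0 1 - w 1 5) / 2) ((w 0 2 - w 2 5) / 2)
              ((w 0 3 - w 3 5) / 2) ((w 0 4 - w 4 5) / 2)];
        [:: Quat ((w 0 1 + w 1 5) / 2) ((- w 0 2 - w 2 5) / 2)
              ((- w 0 3 - w 3 5) / 2) ((- w 0 4 - w 4 5) / 2);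
            Quat (- (w 0 5 / 2)) ((w 1 2 - w 3 4) / 2)
              ((w 1 3 + w 2 4) / 2) ((w 1 4 - w 2 3) / 2)]].
  have hN : N \in sl2H_pred (R := R).
    rewrite unfold_in /mxtrace sum2 !matrix_of_rowsE /=.
    by rewrite quat_addE !QuatE addrN.
  exists (Sl2H hN); apply: so_eq => // i j.
  rewrite matrix_of_rowsE /= !matrix_of_rowsE /= !QuatE.
  by move: i j; apply: ord6P; apply: ord6P => //= _; field.
- apply: so_eq => // [|i j]; first exact: mxcommutator_so.
  rewrite mxcommutatorE !big_ord_recl big_ord0 !matrix_of_rowsE.
  move: i j; apply: ord6P; apply: ord6P => //= _;
    by rewrite !quat_commutatorE !quatM_E ?sl2H_re11; ring.
Qed.

End AssociativeCases.

(** * Octonions in coordinates *)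

Section Octonions.
Variable R : realType.

Lemma ord8P (P : 'I_8 -> Prop) :
  P 0 -> P 1 -> P 2 -> P 3 -> P 4 -> P 5 -> P 6 -> P 7 -> forall i, P i.
Proof.
by move=> h0 h1 h2 h3 h4 h5 h6 h7;
  case=> [[|[|[|[|[|[|[|[|//]]]]]]]] hi]; rewrite ord_numeral.
Qed.

Lemma sum8 (V : nmodType) (F : 'I_8 -> V) : \sum_(i < 8) F i =
  F 0 + F 1 + F 2 + F 3 + F 4 + F 5 + F 6 + F 7.
Proof.
rewrite !big_ord_recl big_ord0 addr0 !addrA.
by do !congr (_ + _); congr F; apply: val_inj.
Qed.

Lemma oct_fstE (x : oct R) : (oct_fst x 0 0 = x 0 0) * (oct_fst x 0 1 = x 0 1) *
  (oct_fst x 0 2 = x 0 2) * (oct_fst x 0 3 = x 0 3).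
Proof. by rewrite !mxE; do !split; congr (x _ _); apply: val_inj. Qed.

Lemma oct_sndE (x : oct R) : (oct_snd x 0 0 = x 0 4) * (oct_snd x 0 1 = x 0 5) *
  (oct_snd x 0 2 = x 0 6) * (oct_snd x 0 3 = x 0 7).
Proof. by rewrite !mxE; do !split; congr (x _ _); apply: val_inj. Qed.

Lemma OctE (p q : quat R) :
  (Oct p q 0 0 = p 0 0) * (Oct p q 0 1 = p 0 1) *
  (Oct p q 0 2 = p 0 2) * (Oct p q 0 3 = p 0 3) *
  (Oct p q 0 4 = q 0 0) * (Oct p q 0 5 = q 0 1) *
  (Oct p q 0 6 = q 0 2) * (Oct p q 0 7 = q 0 3).
Proof.
have L (i : 'I_4) (j : 'I_8) : j = i :> nat -> Oct p q 0 j = p 0 i.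
  move=> h; have -> : j = lshift 4 i by apply: val_inj.
  exact: row_mxEl.
have H (i : 'I_4) (j : 'I_8) : j = (4 + i)%N :> nat -> Oct p q 0 j = q 0 i.
  move=> h; have -> : j = rshift 4 i by apply: val_inj.
  exact: row_mxEr.
by do !split; (apply: L || apply: H).
Qed.

Lemma oct_mulE (x y : oct R) :
  ((oct_mul x y) 0 0 =
      x 0 0 * y 0 0 - x 0 1 * y 0 1 - x 0 2 * y 0 2 - x 0 3 * y 0 3
      - x 0 4 * y 0 4 - x 0 5 * y 0 5 - x 0 6 * y 0 6 - x 0 7 * y 0 7) *
  ((oct_mul x y) 0 1 =
      x 0 0 * y 0 1 + x 0 1 * y 0 0 + x 0 2 * y 0 3 - x 0 3 * y 0 2
      + x 0 4 * y 0 5 - x 0 5 * y 0 4 - x 0 6 * y 0 7 + x 0 7 * y 0 6) *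
  ((oct_mul x y) 0 2 =
      x 0 0 * y 0 2 - x 0 1 * y 0 3 + x 0 2 * y 0 0 + x 0 3 * y 0 1
      + x 0 4 * y 0 6 + x 0 5 * y 0 7 - x 0 6 * y 0 4 - x 0 7 * y 0 5) *
  ((oct_mul x y) 0 3 =
      x 0 0 * y 0 3 + x 0 1 * y 0 2 - x 0 2 * y 0 1 + x 0 3 * y 0 0
      + x 0 4 * y 0 7 - x 0 5 * y 0 6 + x 0 6 * y 0 5 - x 0 7 * y 0 4) *
  ((oct_mul x y) 0 4 =
      x 0 0 * y 0 4 - x 0 1 * y 0 5 - x 0 2 * y 0 6 - x 0 3 * y 0 7
      + x 0 4 * y 0 0 + x 0 5 * y 0 1 + x 0 6 * y 0 2 + x 0 7 * y 0 3) *
  ((oct_mul x y) 0 5 =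
      x 0 0 * y 0 5 + x 0 1 * y 0 4 - x 0 2 * y 0 7 + x 0 3 * y 0 6
      - x 0 4 * y 0 1 + x 0 5 * y 0 0 - x 0 6 * y 0 3 + x 0 7 * y 0 2) *
  ((oct_mul x y) 0 6 =
      x 0 0 * y 0 6 + x 0 1 * y 0 7 + x 0 2 * y 0 4 - x 0 3 * y 0 5
      - x 0 4 * y 0 2 + x 0 5 * y 0 3 + x 0 6 * y 0 0 - x 0 7 * y 0 1) *
  ((oct_mul x y) 0 7 =
      x 0 0 * y 0 7 - x 0 1 * y 0 6 + x 0 2 * y 0 5 + x 0 3 * y 0 4
      - x 0 4 * y 0 3 - x 0 5 * y 0 2 + x 0 6 * y 0 1 + x 0 7 * y 0 0).
Proof.
rewrite /oct_mul !OctE !(quat_addE, quat_oppE) !QuatE !oct_fstE !oct_sndE.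
by do !split; ring.
Qed.

Lemma oct_commE (d x : oct R) i :
  oct_comm d x 0 i = oct_mul d x 0 i - oct_mul x d 0 i.
Proof. by rewrite !mxE. Qed.

(** Real parts cancel in the commutator; what remains is twice the cross product on R^7. *)
Lemma oct_comm_coord (d x : oct R) :
  ((oct_comm d x) 0 0 = 0) *
  ((oct_comm d x) 0 1 =
   2 * (d 0 2 * x 0 3 - d 0 3 * x 0 2 + d 0 4 * x 0 5
       - d 0 5 * x 0 4 - d 0 6 * x 0 7 + d 0 7 * x 0 6)) *
  ((oct_comm d x) 0 2 =
   2 * (d 0 3 * x 0 1 - d 0 1 * x 0 3 + d 0 4 * x 0 6
       + d 0 5 * x 0 7 - d 0 6 * x 0 4 - d 0 7 * x 0 5)) *
  ((oct_comm d x) 0 3 =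
   2 * (d 0 1 * x 0 2 - d 0 2 * x 0 1 + d 0 4 * x 0 7
       - d 0 5 * x 0 6 + d 0 6 * x 0 5 - d 0 7 * x 0 4)) *
  ((oct_comm d x) 0 4 =
   2 * (d 0 5 * x 0 1 - d 0 1 * x 0 5 - d 0 2 * x 0 6
       - d 0 3 * x 0 7 + d 0 6 * x 0 2 + d 0 7 * x 0 3)) *
  ((oct_comm d x) 0 5 =
   2 * (d 0 1 * x 0 4 - d 0 2 * x 0 7 + d 0 3 * x 0 6
       - d 0 4 * x 0 1 - d 0 6 * x 0 3 + d 0 7 * x 0 2)) *
  ((oct_comm d x) 0 6 =
   2 * (d 0 1 * x 0 7 + d 0 2 * x 0 4 - d 0 3 * x 0 5
       - d 0 4 * x 0 2 + d 0 5 * x 0 3 - d 0 7 * x 0 1)) *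
  ((oct_comm d x) 0 7 =
   2 * (d 0 2 * x 0 5 - d 0 1 * x 0 6 + d 0 3 * x 0 4
       - d 0 4 * x 0 3 - d 0 5 * x 0 2 + d 0 6 * x 0 1)).
Proof. by do !split; rewrite oct_commE !oct_mulE; ring. Qed.

Lemma oct_comm_linear (d : oct R) : linear (oct_comm d).
Proof.
by move=> a x y; rewrite /oct_comm !oct_mulP scalerBr opprD addrACA.
Qed.

HB.instance Definition _ (d : oct R) :=
  GRing.isLinear.Build R (oct R) (oct R) _ (oct_comm d) (oct_comm_linear d).

Lemma oct_mulN (x y : oct R) :
  (oct_mul (- x) y = - oct_mul x y) * (oct_mul x (- y) = - oct_mul x y).
Proof.
have := oct_mulP (-1) x 0 y; have := oct_mulP (-1) y 0 x.
by rewrite !scaleN1r !oct_mul0 !addr0 => -[_ ->] [-> _].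
Qed.

(** Octonions are row vectors; the map whose columns are those of [A] is therefore
    [oct_mulmx A^T]. *)
Definition oct_mulmx (A : 'M[R]_8) (x : oct R) : oct R := (x : 'rV_8) *m A.

Lemma oct_mulmx_linear (A : 'M[R]_8) : linear (oct_mulmx A).
Proof. by move=> a x y; rewrite /oct_mulmx mulmxDl scalemxAl. Qed.

HB.instance Definition _ (A : 'M[R]_8) :=
  GRing.isLinear.Build R (oct R) (oct R) _ (oct_mulmx A) (oct_mulmx_linear A).

Lemma oct_eE (i j : 'I_8) : (oct_e R i) 0 j = (j == i)%:R.
Proof. by rewrite mxE. Qed.

Lemma oct_end_coord (f : 'End(oct R)) (x : oct R) i :
  (f x : oct R) 0 i = \sum_j x 0 j * (f (oct_e R j) : oct R) 0 i.
Proof.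
have {1}-> : x = \sum_j x 0 j *: oct_e R j :> oct R by exact: row_sum_delta.
rewrite linear_sum summxE; apply: eq_bigr => j _.
by rewrite linearZ mxE.
Qed.

Lemma oct_addE (x y : oct R) i : (x + y) 0 i = x 0 i + y 0 i.
Proof. exact: mxE. Qed.

Lemma oct_oppE (x : oct R) i : (- x) 0 i = - x 0 i.
Proof. exact: mxE. Qed.

Lemma oct_scaleE a (x : oct R) i : (a *: x) 0 i = a * x 0 i.
Proof. exact: mxE. Qed.

Lemma oct_mul_re (x y : oct R) :
  oct_mul x y 0 0 = 2 * x 0 0 * y 0 0 - \sum_i x 0 i * y 0 i.
Proof. by rewrite oct_mulE sum8; ring. Qed.

(** Polarization of x^2 = -|x|^2 on O'. *)
Lemma oct_anticomm (x y : oct R) : x 0 0 = 0 -> y 0 0 = 0 ->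
  oct_mul x y + oct_mul y x = (- 2 * \sum_i x 0 i * y 0 i) *: oct_e R 0.
Proof.
move=> x0 y0; apply/rowP; apply: ord8P;
  by rewrite oct_addE oct_scaleE oct_eE !oct_mulE sum8 x0 y0 /=; ring.
Qed.

Lemma oct_sum_e (x : oct R) i : \sum_j x 0 j * (oct_e R i) 0 j = x 0 i.
Proof.
rewrite (bigD1 i) //= big1 => [|j ji]; rewrite oct_eE ?eqxx ?(negPf ji).
  by rewrite mulr1 addr0.
by rewrite mulr0.
Qed.

Lemma oct_mul1 (x : oct R) :
  (oct_mul (oct_e R 0) x = x) * (oct_mul x (oct_e R 0) = x).
Proof.
by split; apply/rowP; apply: ord8P; rewrite oct_mulE !oct_eE /=; ring.
Qed.

Lemma oct_anticomm_im (x y : oct R) k : k != 0 ->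
  oct_mul x y 0 k + oct_mul y x 0 k = 2 * (x 0 0 * y 0 k + y 0 0 * x 0 k).
Proof. by move: k; apply: ord8P => // _; rewrite !oct_mulE; ring. Qed.

Lemma oct_dotC (x y : oct R) :
  \sum_i x 0 i * y 0 i = \sum_i y 0 i * x 0 i.
Proof. by apply: eq_bigr => i _; rewrite mulrC. Qed.

(** * Skew maps: the splitting so(7) = C(O') + Der(O) *)

Definition octonion_skew (f : 'End(oct R)) : Prop := forall i j,
  (f (oct_e R j) : oct R) 0 i = - (f (oct_e R i) : oct R) 0 j.

Section Derivations.
Variables (f : 'End(oct R))
  (fM : forall x y : oct R,
    f (oct_mul x y) = oct_mul (f x) y + oct_mul x (f y)).

Lemma derivation_1 : f (oct_e R 0) = 0.
Proof.
have /eqP := fM (oct_e R 0) (oct_e R 0).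
by rewrite !oct_mul1 -subr_eq0 opprD addNKr oppr_eq0 => /eqP.
Qed.

(** Here xy + yx is a multiple of 1, which [f] kills. *)
Lemma derivation_anticomm (x y : oct R) : x 0 0 = 0 -> y 0 0 = 0 ->
  oct_mul (f x) y + oct_mul x (f y) + (oct_mul (f y) x + oct_mul y (f x)) = 0.
Proof.
move=> x0 y0; have := congr1 f (oct_anticomm x0 y0).
by rewrite linearZ linearD /= derivation_1 scaler0 !fM.
Qed.

Lemma derivation_skew : octonion_skew f.
Proof.
have f0 j : j != 0 -> (f (oct_e R j) : oct R) 0 0 = 0.
  move=> j0; have e0 : (oct_e R j) 0 0 = 0 by rewrite oct_eE eq_sym (negPf j0).
  (* Coordinate j of the relation for x = y = e_j is 4 Re(f e_j). *)
  have /rowP/(_ j) := derivation_anticomm e0 e0.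
  rewrite !oct_addE [RHS]mxE.
  have := oct_anticomm_im (f (oct_e R j)) (oct_e R j) j0.
  by rewrite e0 oct_eE eqxx mulr1 mul0r addr0; lra.
move=> i j; have [->|i0] := eqVneq i 0.
  rewrite derivation_1 [X in - X]mxE oppr0.
  by have [->|/f0 //] := eqVneq j 0; rewrite derivation_1 mxE.
have [->|j0] := eqVneq j 0; first by rewrite derivation_1 mxE f0 ?oppr0.
have ei0 : (oct_e R i) 0 0 = 0 by rewrite oct_eE eq_sym (negPf i0).
have ej0 : (oct_e R j) 0 0 = 0 by rewrite oct_eE eq_sym (negPf j0).
(* The real part of xy is -<x, y> when x or y is imaginary, so coordinate 0 reads <f e_i, e_j> +
   <e_i, f e_j> = 0. *)
have /rowP/(_ 0) := derivation_anticomm ei0 ej0.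
rewrite !oct_addE [RHS]mxE !oct_mul_re ei0 ej0.
rewrite (oct_dotC (oct_e R i)) (oct_dotC (oct_e R j)) !oct_sum_e.
by lra.
Qed.

End Derivations.

Lemma oct_comm_skew (d x y : oct R) :
  \sum_i oct_comm d x 0 i * y 0 i = - \sum_i oct_comm d y 0 i * x 0 i.
Proof. by rewrite !sum8 !oct_comm_coord; ring. Qed.

Lemma C_skew (f : 'End(oct R)) d : (forall x : oct R, f x = oct_comm d x) ->
  octonion_skew f.
Proof.
move=> fC i j; rewrite !fC; have := oct_comm_skew d (oct_e R j) (oct_e R i).
by rewrite !oct_sum_e.
Qed.

(* The equations for e_1, ..., e_7 in this order, each solved for one entry   *)
(* of S; they say that S is orthogonal to all C_(e_k).                        *)
Lemma skew_derivation (f : 'End(oct R)) :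
  let S i j := (f (oct_e R j) : oct R) 0 i in
  octonion_skew f -> (forall i, S i 0 = 0) ->
  S 6 7 = S 2 3 + S 4 5 -> S 5 7 = S 1 3 - S 4 6 -> S 5 6 = S 1 2 + S 4 7 ->
  S 3 7 = - S 1 5 - S 2 6 -> S 3 6 = S 2 7 - S 1 4 -> S 3 5 = S 1 7 + S 2 4 ->
  S 3 4 = S 1 6 - S 2 5 -> f \in @Der_pred R.
Proof.
move=> S SN S0 S67 S57 S56 S37 S36 S35 S34; apply/asboolP=> x y.
have SN' i j : S i j = - S j i by apply: SN.
have fS (z : oct R) i : f z 0 i = \sum_j z 0 j * S i j by exact: oct_end_coord.
clearbody S.
have S0j j : S 0 j = 0 by rewrite SN' S0 oppr0.
have Sii i : S i i = 0.
  by apply/eqP; rewrite -[_ == 0](mulrn_eq0 _ 2) mulr2n {2}SN' addrN.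
(* [f] through the 21 entries of [S] above the diagonal, rows 1 to 7. *)
have fE (z : oct R) : (f z 0 0 = 0) *
  (f z 0 1 = S 1 2 * z 0 2 + S 1 3 * z 0 3 + S 1 4 * z 0 4
     + S 1 5 * z 0 5 + S 1 6 * z 0 6 + S 1 7 * z 0 7) *
  (f z 0 2 = - (S 1 2 * z 0 1) + S 2 3 * z 0 3 + S 2 4 * z 0 4
     + S 2 5 * z 0 5 + S 2 6 * z 0 6 + S 2 7 * z 0 7) *
  (f z 0 3 = - (S 1 3 * z 0 1) - S 2 3 * z 0 2 + S 3 4 * z 0 4
     + S 3 5 * z 0 5 + S 3 6 * z 0 6 + S 3 7 * z 0 7) *
  (f z 0 4 = - (S 1 4 * z 0 1) - S 2 4 * z 0 2 - S 3 4 * z 0 3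
     + S 4 5 * z 0 5 + S 4 6 * z 0 6 + S 4 7 * z 0 7) *
  (f z 0 5 = - (S 1 5 * z 0 1) - S 2 5 * z 0 2 - S 3 5 * z 0 3
     - S 4 5 * z 0 4 + S 5 6 * z 0 6 + S 5 7 * z 0 7) *
  (f z 0 6 = - (S 1 6 * z 0 1) - S 2 6 * z 0 2 - S 3 6 * z 0 3
     - S 4 6 * z 0 4 - S 5 6 * z 0 5 + S 6 7 * z 0 7) *
  (f z 0 7 = - (S 1 7 * z 0 1) - S 2 7 * z 0 2 - S 3 7 * z 0 3
     - S 4 7 * z 0 4 - S 5 7 * z 0 5 - S 6 7 * z 0 6).
  do !split; rewrite fS sum8 ?S0 ?S0j ?Sii
    ?(SN' 2 1) ?(SN' 3 1) ?(SN' 3 2) ?(SN' 4 1) ?(SN' 4 2)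
    ?(SN' 4 3) ?(SN' 5 1) ?(SN' 5 2) ?(SN' 5 3) ?(SN' 5 4)
    ?(SN' 6 1) ?(SN' 6 2) ?(SN' 6 3) ?(SN' 6 4) ?(SN' 6 5)
    ?(SN' 7 1) ?(SN' 7 2) ?(SN' 7 3) ?(SN' 7 4) ?(SN' 7 5)
    ?(SN' 7 6); ring.
apply/rowP=> i; rewrite oct_addE; move: i.
(* The seven equations leave 14 free entries, the dimension of g_2; the Leibniz rule is a polynomial
   identity in them. *)
apply: ord8P; rewrite fE !oct_mulE !fE S67 S57 S56 S37 S36 S35 S34; ring.
Qed.

Lemma Der_octonionsP (D : Der_octonions R) (x y : oct R) :
  D (oct_mul x y) = oct_mul (D x) y + oct_mul x (D y).
Proof. by have := valP D; rewrite unfold_in => /asboolP. Qed.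

Lemma Der_octonions_skew (D : Der_octonions R) : octonion_skew D.
Proof. exact/derivation_skew/Der_octonionsP. Qed.

Lemma C_octonionsP (C : C_octonions R) :
  exists2 d : oct R, d 0 0 = 0 & forall x : oct R, C x = oct_comm d x.
Proof.
by have := valP C; rewrite unfold_in => /asboolP[d [d0 dC]]; exists d.
Qed.

Lemma C_octonions_skew (C : C_octonions R) : octonion_skew C.
Proof. by have [d _ dC] := C_octonionsP C; exact: C_skew dC. Qed.

Let ring_units :=
  (mulr0, mulr1, mul0r, mul1r, addr0, add0r, subr0, sub0r, oppr0).

(** By alternativity [d, xy] - [d, x]y - x[d, y] is -3 times the associator of d, x, y, and no
    nonzero imaginary d has all these associators zero. *)
Lemma C_derivation_eq0 (d : oct R) : d 0 0 = 0 ->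
  (forall x y : oct R, oct_comm d (oct_mul x y) =
     oct_mul (oct_comm d x) y + oct_mul x (oct_comm d y)) -> d = 0.
Proof.
move=> d0 dM.
have h i j m k : oct_mul (oct_e R i) (oct_e R j) = oct_e R m ->
    oct_comm d (oct_e R m) 0 k =
      oct_mul (oct_comm d (oct_e R i)) (oct_e R j) 0 k +
      oct_mul (oct_e R i) (oct_comm d (oct_e R j)) 0 k.
  by move=> <-; rewrite dM oct_addE.
have e12 : oct_mul (oct_e R 1) (oct_e R 2) = oct_e R 3.
  by apply/rowP; apply: ord8P; rewrite oct_mulE !oct_eE /=; ring.
have e14 : oct_mul (oct_e R 1) (oct_e R 4) = oct_e R 5.
  by apply/rowP; apply: ord8P; rewrite oct_mulE !oct_eE /=; ring.
have e24 : oct_mul (oct_e R 2) (oct_e R 4) = oct_e R 6.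
  by apply/rowP; apply: ord8P; rewrite oct_mulE !oct_eE /=; ring.
(* For each of d_1, ..., d_7, a product e_i e_j = e_m and a coordinate at which the Leibniz defect
   is 6 d_k up to sign. *)
apply/rowP; apply: ord8P; rewrite [RHS]mxE //;
  [have := h 2 4 6 7 e24 | have := h 1 4 5 7 e14 | have := h 1 4 5 6 e14
  |have := h 1 2 3 7 e12 | have := h 1 2 3 6 e12 | have := h 1 2 3 5 e12
  |have := h 1 2 3 4 e12].
all: rewrite [X in _ = X + _]oct_mulE [X in _ = _ + X]oct_mulE.
all: rewrite !oct_eE /= !ring_units.
all: rewrite !oct_comm_coord !oct_eE /= !ring_units; lra.
Qed.

Lemma oct_eq0 (x : oct R) :
  x 0 0 = 0 -> (forall k, x 0 (lift ord0 k) = 0) -> x = 0.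
Proof.
move=> x0 xk; apply/rowP => i; rewrite [RHS]mxE.
by case: (unliftP ord0 i) => [k ->|->]; [exact: xk | exact: x0].
Qed.

Lemma C_Der_inj (C : C_octonions R) (D : Der_octonions R) :
  (forall k l : 'I_7, C (oct_e R (lift ord0 l)) 0 (lift ord0 k) +
    D (oct_e R (lift ord0 l)) 0 (lift ord0 k) = 0 :> R) -> C = 0 /\ D = 0.
Proof.
move=> CD; have [d d0 dC] := C_octonionsP C.
have C1 : C (oct_e R 0) = 0 by rewrite dC /oct_comm !oct_mul1 subrr.
have D1 : D (oct_e R 0) = 0 by exact/derivation_1/Der_octonionsP.
(* Both maps kill 1 and are skew, so vanishing on the imaginary block spreads to all of O; then C_d
   = -D is a derivation. *)
have S0 i j : C (oct_e R j) 0 i + D (oct_e R j) 0 i = 0 :> R.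
  case: (unliftP ord0 j) => [l ->|->]; last first.
    by rewrite C1 D1 mxE addr0.
  case: (unliftP ord0 i) => [k ->|->]; first exact: CD.
  by rewrite C_octonions_skew Der_octonions_skew C1 D1 mxE oppr0 addr0.
have DC (x : oct R) : D x = - oct_comm d x.
  apply/rowP=> i; rewrite oct_oppE -dC; apply/eqP; rewrite -addr_eq0; apply/eqP.
  rewrite !(oct_end_coord _ x) -big_split /= big1 // => j _.
  by rewrite -mulrDr addrC S0 mulr0.
have d00 : d = 0.
  apply: C_derivation_eq0 => // x y; apply: oppr_inj.
  by rewrite -DC Der_octonionsP !DC !oct_mulN opprD.
split; apply/val_inj/lfunP => x; rewrite [RHS]lfunE /=.
  by rewrite dC d00 /oct_comm !oct_mul0 subr0.
by rewrite DC d00 /oct_comm !oct_mul0 subr0 oppr0.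
Qed.

(** C_d is the orthogonal projection of [A] to C(O'); the remainder satisfies the seven equations of
    [skew_derivation]. *)
Lemma skew_decomposition (A : 'M[R]_8) :
  (forall i j, A i j = - A j i) -> (forall i, A i 0 = 0) ->
  exists (C : C_octonions R) (D : Der_octonions R), forall i j,
    C (oct_e R j) 0 i + D (oct_e R j) 0 i = A i j.
Proof.
move=> AN A0.
(* d_k is the normalized inner product of A with C_(e_k). *)
pose d : oct R := \row_i nth 0 [:: 0;
  (A 6 7 - A 2 3 - A 4 5) / 6; (A 1 3 - A 4 6 - A 5 7) / 6;
  (A 5 6 - A 1 2 - A 4 7) / 6; (A 1 5 + A 2 6 + A 3 7) / 6;
  (A 2 7 - A 1 4 - A 3 6) / 6; (A 3 5 - A 1 7 - A 2 4) / 6;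
  (A 1 6 - A 2 5 - A 3 4) / 6] i.
have CE (x : oct R) : linfun (oct_comm d) x = oct_comm d x by rewrite lfunE.
have CP : linfun (oct_comm d) \in @C_pred R.
  by apply/asboolP; exists d; rewrite mxE.
pose f : 'End(oct R) := linfun (oct_mulmx A^T) - linfun (oct_comm d).
have fE i j : f (oct_e R j) 0 i = A i j - oct_comm d (oct_e R j) 0 i.
  rewrite /f add_lfunE opp_lfunE CE lfunE oct_addE oct_oppE; congr (_ - _).
  by rewrite /= /oct_mulmx -rowE !mxE.
have fP : f \in @Der_pred R.
  apply: skew_derivation.
  - by move=> i j; have := C_skew CE i j; rewrite !fE AN !CE => ->; ring.
  - by move=> i; rewrite fE A0 /oct_comm !oct_mul1 subrr mxE subr0.
  1-7: rewrite !fE !oct_comm_coord !oct_eE /= !ring_units.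
  1-7: by rewrite !mxE /=; field.
exists (COctonions CP), (DerOctonions fP) => i j /=.
by rewrite fE CE addrC subrK.
Qed.

End Octonions.

(* The coordinates x_0, x_1 = Re x, (x_2, ..., x_8) = Im x and x_9 of the     *)
(* hermitian matrix X.                                                        *)
Inductive block_index := iTime | iRe | iIm of 'I_7 | iLast.

(** The shifts follow the nesting 1 + (1 + (7 + 1)) of the blocks in [phiO_mx] and [phiO_end]. *)
Definition ord_of_block (p : block_index) : 'I_10 :=
  match p with
  | iTime => lshift (1 + (7 + 1)) (ord0 : 'I_1)
  | iRe => rshift 1 (lshift (7 + 1) (ord0 : 'I_1))
  | iIm k => rshift 1 (rshift 1 (lshift 1 k))
  | iLast => rshift 1 (rshift 1 (rshift 7 (ord0 : 'I_1)))
  end.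

Lemma block_indexP (P : 'I_10 -> Prop) :
  (forall p, P (ord_of_block p)) -> forall i, P i.
Proof.
move=> hP i.
have [j ->|{}i ->] := @split_ordP 1 (1 + (7 + 1)) i.
  by rewrite ord1; exact: (hP iTime).
have [j ->|{}i ->] := split_ordP i; first by rewrite ord1; exact: (hP iRe).
have [j ->|j ->] := split_ordP i; first exact: (hP (iIm j)).
by rewrite ord1; exact: (hP iLast).
Qed.

(** * The case O, block by block *)

Section OctonionIso.
Variable R : realType.

Let split_lshift m n (j : 'I_m) : fintype.split (lshift n j) = inl j.
Proof. exact: (unsplitK (inl j)). Qed.

Let split_rshift m n (j : 'I_n) : fintype.split (rshift m j) = inr j.
Proof. exact: (unsplitK (inr j)). Qed.

Lemma phiO_mxE (N : traceless (oct R)) p q :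
  phiO_mx N (ord_of_block p) (ord_of_block q) =
  let a k := N 0 0 0 k in let b k := N 0 1 0 k in let c k := N 1 0 0 k in
  match p, q with
  | iTime, iTime => 0
  | iTime, iRe => b 0 + c 0
  | iTime, iIm l => b (lift ord0 l) - c (lift ord0 l)
  | iTime, iLast => 2 * a 0
  | iRe, iTime => b 0 + c 0
  | iRe, iRe => 0
  | iRe, iIm l => - (2 * a (lift ord0 l))
  | iRe, iLast => c 0 - b 0
  | iIm k, iTime => b (lift ord0 k) - c (lift ord0 k)
  | iIm k, iRe => 2 * a (lift ord0 k)
  | iIm k, iIm l => 0
  | iIm k, iLast => - (b (lift ord0 k) + c (lift ord0 k))
  | iLast, iTime => 2 * a 0
  | iLast, iRe => b 0 - c 0
  | iLast, iIm l => b (lift ord0 l) + c (lift ord0 l)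
  | iLast, iLast => 0
  end.
Proof.
case: p => [||k|]; case: q => [||l|]; rewrite /phiO_mx /ord_of_block;
  by do 12 ?rewrite ?mxE ?split_lshift ?split_rshift //=.
Qed.

Lemma phiO_endE (f : 'End(oct R)) p q :
  phiO_end f (ord_of_block p) (ord_of_block q) =
  match p, q with
  | iIm k, iIm l => (f (oct_e R (lift ord0 l)) : oct R) 0 (lift ord0 k)
  | _, _ => 0
  end.
Proof.
case: p => [||k|]; case: q => [||l|]; rewrite /phiO_end /ord_of_block;
  by do 12 ?rewrite ?mxE ?split_lshift ?split_rshift //=.
Qed.

Lemma phiO_addE (M : sl2O R) i j : phiO M i j =
  phiO_mx M.1.1 i j + phiO_end M.1.2 i j + phiO_end M.2 i j.
Proof. by rewrite /phiO mxE [X in X + _]mxE. Qed.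

Lemma phiO_so (M : sl2O R) : phiO M \in @so_pred R 9.
Proof.
apply/so_predP; apply: block_indexP => p; apply: block_indexP => q.
rewrite !phiO_addE !phiO_mxE !phiO_endE /msign.
case: p => [||k|]; case: q => [||l|] /=; try by ring.
by rewrite C_octonions_skew Der_octonions_skew; ring.
Qed.

Lemma phiO_mx_linear : linear (@phiO_mx R).
Proof.
move=> a x y; apply/matrixP; apply: block_indexP => p; apply: block_indexP => q.
rewrite mx_linE !phiO_mxE /= !(mat2_linE (K := oct R)).
by case: p => [||k|]; case: q => [||l|]; rewrite ?oct_addE ?oct_scaleE; ring.
Qed.

Lemma phiO_end_linear : linear (@phiO_end R).
Proof.
move=> a f g; apply/matrixP; apply: block_indexP => p; apply: block_indexP => q.
rewrite mx_linE !phiO_endE.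
case: p => [||k|]; case: q => [||l|]; rewrite ?mulr0 ?addr0 //.
by rewrite !lfunE /= !lfunE /= oct_addE oct_scaleE.
Qed.

Lemma phiO_linear : linear (@phiO R).
Proof.
have lin3 a (u u' v v' w w' : 'M[R]_10) :
    a *: u + u' + (a *: v + v') + (a *: w + w') =
    a *: (u + v + w) + (u' + v' + w').
  by rewrite !scalerDr (addrACA (a *: u)) (addrACA (a *: u + a *: v)).
move=> a x y; rewrite /phiO /= phiO_mx_linear !phiO_end_linear; exact: lin3.
Qed.

Lemma phiO_isomorphism : exists f : sl2O R -> so R 9,
  [/\ forall M, f M = phiO M :> 'M[R]_10, linear f, bijective f &
    is_lie_isomorphism (@sl2O_bracket R) (@so_bracket R 9) f].
Proof.
have phisur (w : 'M[R]_10) : w \in @so_pred R 9 -> exists M, phiO M = w.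
  move=> hw; have /so_predP ws := hw.
  pose vec (x0 : R) (v : 'I_7 -> R) : oct R :=
    \row_i (if unlift ord0 i is Some k then v k else x0).
  have vec0 x0 v : vec x0 v 0 0 = x0 by rewrite mxE unlift_none.
  have vecS x0 v k : vec x0 v 0 (lift ord0 k) = v k by rewrite mxE liftK.
  pose e := ord_of_block.
  have [N [Na Nb Nc]] := traceless_of_entries (K := oct R)
    (vec (w (e iTime) (e iLast) / 2) (fun l => - w (e iRe) (e (iIm l)) / 2))
    (vec ((w (e iTime) (e iRe) - w (e iRe) (e iLast)) / 2)
      (fun l => (w (e iTime) (e (iIm l)) - w (e (iIm l)) (e iLast)) / 2))
    (vec ((w (e iTime) (e iRe) + w (e iRe) (e iLast)) / 2)
      (fun l => (- w (e iTime) (e (iIm l)) - w (e (iIm l)) (e iLast)) / 2)).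
  (* The middle 7x7 block of [w], extended by zero on e_0. *)
  pose A : 'M[R]_8 := \matrix_(i, j)
    if unlift ord0 i is Some k then
      if unlift ord0 j is Some l then w (e (iIm k)) (e (iIm l)) else 0
    else 0.
  have AE k l : A (lift ord0 k) (lift ord0 l) = w (e (iIm k)) (e (iIm l)).
    by rewrite mxE !liftK.
  have AN i j : A i j = - A j i.
    rewrite !mxE; case: (unlift ord0 i) => [k|]; case: (unlift ord0 j) => [l|];
      rewrite ?oppr0 //.
    by have := ws (e (iIm k)) (e (iIm l)); rewrite /msign /=; lra.
  have A0 i : A i 0 = 0 by rewrite mxE unlift_none; case: unlift.
  have [C [D CD]] := skew_decomposition AN A0.
  exists ((N, C), D); apply: so_eq => //; first exact: phiO_so.
  apply: block_indexP => p; apply: block_indexP => q.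
  rewrite phiO_addE phiO_mxE !phiO_endE /= Na Nb Nc.
  case: p => [||k|]; case: q => [||l|] //= pq; rewrite ?vec0 ?vecS -?/(e _);
    try by field.
    by rewrite add0r CD AE.
  (* Row [iLast] and column [iIm l] lie below the diagonal: 9 < l + 2 contradicts l < 7. *)
  by have := ltn_trans (pq : (7 < l)%N) (ltn_ord l).
apply: matrix_so_isomorphism.
- exact: phiO_linear.
- move=> [[N C] D] h0; have h p q := h0 (ord_of_block p) (ord_of_block q).
  have [C0 D0] : C = 0 /\ D = 0.
    apply: C_Der_inj => k l; have := h (iIm k) (iIm l).
    by rewrite phiO_addE phiO_mxE !phiO_endE /= add0r.
  have N0 : N = 0.
    apply: traceless_eq0; apply: oct_eq0 => [|k]; rewrite ?mxE.
    - have := h iTime iLast; rewrite phiO_addE phiO_mxE !phiO_endE /=; lra.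
    - have := h iRe (iIm k); rewrite phiO_addE phiO_mxE !phiO_endE /=; lra.
    - have := h iTime iRe; have := h iRe iLast.
      rewrite !phiO_addE !phiO_mxE !phiO_endE /=; lra.
    - have := h iTime (iIm k); have := h (iIm k) iLast.
      rewrite !phiO_addE !phiO_mxE !phiO_endE /=; lra.
    - have := h iTime iRe; have := h iRe iLast.
      rewrite !phiO_addE !phiO_mxE !phiO_endE /=; lra.
    - have := h iTime (iIm k); have := h (iIm k) iLast.
      rewrite !phiO_addE !phiO_mxE !phiO_endE /=; lra.
  by rewrite N0 C0 D0.
- exact: phiO_so.
- exact: phisur.
- move=> M N; have [P PE] : exists P, phiO P = mxcommutator (phiO M) (phiO N).
    by apply/phisur/mxcommutator_so; exact: phiO_so.
  (* The preimage [P] rules out the default value of [xget]. *)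
  by rewrite /sl2O_bracket; case: xgetP => [Q -> //|/(_ P)].
Qed.

End OctonionIso.

Theorem mainTheorem3 (R : realType) :
  [/\ exists f : sl2R R -> so R 2,
        (forall N, f N = phiR N :> 'M[R]_3) /\
        is_lie_isomorphism (@sl2R_bracket R) (@so_bracket R 2) f,
      exists f : sl2C R -> so R 3,
        (forall N, f N = phiC N :> 'M[R]_4) /\
        is_lie_isomorphism (@sl2C_bracket R) (@so_bracket R 3) f,
      exists f : sl2H R -> so R 5,
        (forall N, f N = phiH N :> 'M[R]_6) /\
        is_lie_isomorphism (@sl2H_bracket R) (@so_bracket R 5) f
    & exists f : sl2O R -> so R 9,
        [/\ forall M, f M = phiO M :> 'M[R]_10,
            linear f,
            bijective f
          & is_lie_isomorphism (@sl2O_bracket R) (@so_bracket R 9) f]].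
Proof.
have [f [fE _ _ fiso]] := phiR_isomorphism R.
have [g [gE _ _ giso]] := phiC_isomorphism R.
have [h [hE _ _ hiso]] := phiH_isomorphism R.
split; [by exists f | by exists g | by exists h | exact: phiO_isomorphism].
Qed.
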